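(* Let $n\ge 4$ and let $T_1'$ and $T_2'$ be $(n-2)$-leaf binary trees. Let $1 \leq i \leq n-2$, and let $T_1$ and $T_2$ be the $n$-leaf trees obtained from $T_1'$ and $T_2'$ by triplicating leaf $i$. If $w = w_1 \cdots w_{n-2}$ is a parse word for $T_1'$ and $T_2'$ (i.e. both trees parse $w$), then $w_1 \cdots w_{i-1} w_i w_i w_i w_{i+1} \cdots w_{n-2}$ is a parse word for $T_1$ and $T_2$.
   Context: A binary tree is a rooted ordered tree in which each vertex has either $0$ or $2$ children; its leaves are numbered $1,2,\dots$ from left to right. Let $G$ be the context-free grammar with start symbols $0,1,2$ and rules $0\to 12$, $0\to 21$, $1\to 02$, $1\to 20$, $2\to 01$, $2\to 10$. An $n$-leaf binary tree $T$ parses a word $w$ of length $n$ on $\{0,1,2\}$ if there is a labeling of the vertices of $T$ by $0,1,2$ such that the leaves, from left to right, are labeled with the letters of $w$, and at every internal vertex the label of the vertex together with the labels of its left and right children form a rule of $G$ (i.e. the three labels are pairwise distinct). Triplicating leaf $i$ of a binary tree $T'$ with at least two leaves: let $S$ be the subtree hanging from the sibling vertex of leaf $i$. Writing $(A,B)$ for the tree with left subtree $A$ and right subtree $B$ and $\bullet$ for a leaf, the subtree of $T'$ at the parent of leaf $i$ is changed from $(\bullet,S)$ to $(\bullet,(\bullet,(\bullet,S)))$ if leaf $i$ is a left child, and from $(S,\bullet)$ to $(((S,\bullet),\bullet),\bullet)$ if leaf $i$ is a right child; the rest of the tree is unchanged. The resulting tree has two more leaves than $T'$. *)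

(* Defs.v *)
From mathcomp Require Import all_boot zify.

Set Implicit Arguments.
Unset Strict Implicit.
Unset Printing Implicit Defensive.

Inductive btree : Type :=
| Leaf
| Node of btree & btree.

Fixpoint leaves (T : btree) : nat :=
  match T with
  | Leaf => 1
  | Node l r => leaves l + leaves r
  end.

Definition letter := 'I_3.

(* The triple (a, b, c) stands for the rule a -> b c. *)
Definition grammar : seq (nat * nat * nat) :=
  [:: (0, 1, 2); (0, 2, 1); (1, 0, 2); (1, 2, 0); (2, 0, 1); (2, 1, 0)].

Definition rule (a b c : letter) : bool :=
  (val a, val b, val c) \in grammar.

Lemma ruleE (a b c : letter) : rule a b c = [&& a != b, a != c & b != c].
Proof.
by case: a b c => [[|[|[|a]]] // ?] [[|[|[|b]]] // ?] [[|[|[|c]]] // ?].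
Qed.

(* A labeling of the vertices of T is encoded as a tree of shape T that
   carries a letter at each vertex. *)
Inductive ltree : Type :=
| LLeaf of letter
| LNode of letter & ltree & ltree.

Fixpoint shape_of (L : ltree) : btree :=
  match L with
  | LLeaf _ => Leaf
  | LNode _ l r => Node (shape_of l) (shape_of r)
  end.

Definition root_label (L : ltree) : letter :=
  match L with
  | LLeaf a => a
  | LNode a _ _ => a
  end.

Fixpoint leaf_word (L : ltree) : seq letter :=
  match L with
  | LLeaf a => [:: a]
  | LNode _ l r => leaf_word l ++ leaf_word r
  end.

Fixpoint obeys_grammar (L : ltree) : bool :=
  match L with
  | LLeaf _ => true
  | LNode a l r =>
      [&& rule a (root_label l) (root_label r),
          obeys_grammar l & obeys_grammar r]
  end.

(* The root label is unconstrained because 0, 1 and 2 are all start symbols. *)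
Definition parses (T : btree) (w : seq letter) : Prop :=
  exists L : ltree, [/\ shape_of L = T, leaf_word L = w & obeys_grammar L].

(* Leaves are numbered from 1.  The value is meaningful only when T has at
   least two leaves and 1 <= i <= leaves T. *)
Fixpoint triplicate (i : nat) (T : btree) : btree :=
  match T with
  | Leaf => Leaf
  | Node l r =>
      if i <= leaves l then
        match l with
        | Leaf => Node Leaf (Node Leaf (Node Leaf r))
        | Node _ _ => Node (triplicate i l) r
        end
      else
        match r with
        | Leaf => Node (Node (Node l Leaf) Leaf) Leaf
        | Node _ _ => Node l (triplicate (i - leaves l) r)
        end
  end.

Lemma leaves_triplicate (i : nat) (T : btree) :
  2 <= leaves T -> leaves (triplicate i T) = leaves T + 2.
Proof.
have leaves_gt0 U : 0 < leaves U by elim: U => //= l lP r _; rewrite addn_gt0 lP.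
have leaves_gt1 a b : 1 < leaves (Node a b).
  by rewrite /= -[2]/(1 + 1) leq_add.
elim: T i => // l IHl r IHr i _ /=; case: ifP => _.
  case: l IHl => [_|a b IHl]; first by rewrite /=; lia.
  by have /= := IHl i (leaves_gt1 a b); lia.
case: r IHr => [_|a b IHr]; first by rewrite /=; lia.
by have /= := IHr (i - leaves l) (leaves_gt1 a b); lia.
Qed.

(* w_1 ... w_(i-1) w_i w_i w_i w_(i+1) ...  for 1 <= i <= size w; the default
   letter of nth plays no role in that range. *)
Definition triplicate_letter (i : nat) (w : seq letter) : seq letter :=
  take i.-1 w ++ nseq 3 (nth ord0 w i.-1) ++ drop i w.

(* Main.v *)
Require Import Defs.
From mathcomp Require Import all_boot zify.

(** Triplication can be done on a labeled tree without changing the root label.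
    At the parent of leaf [i] the labels [a -> b c] (leaf [b], sibling subtree
    with root [c]) become [a -> b c], [c -> b a], [a -> b c] going down the new
    path, or their mirror images, and these are rules because [a], [b] and [c]
    are pairwise distinct. *)

Lemma size_leaf_word (L : ltree) : size (leaf_word L) = leaves (shape_of L).
Proof. by elim: L => //= a l IHl r IHr; rewrite size_cat IHl IHr. Qed.

(** Together with [triplicate_letter_catr], this follows on words the left or right descent of
    [triplicate], as the leaf word of a node is a concatenation. *)
Lemma triplicate_letter_catl (i : nat) (u v : seq letter) :
  0 < i <= size u ->
  triplicate_letter i (u ++ v) = triplicate_letter i u ++ v.
Proof.
case: i => //= i ltiu; rewrite /triplicate_letter /= -!catA /=.
rewrite nth_cat ltiu takel_cat ?(ltnW ltiu) // drop_cat.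
(* At the boundary [i.+1 = size u], [drop_cat] takes its second branch: all of [u] is dropped and
   nothing of [v]. *)
case: (ltngtP i.+1 (size u)) ltiu => // -> _.
by rewrite subnn drop0 drop_size.
Qed.

Lemma triplicate_letter_catr (i : nat) (u v : seq letter) :
  size u < i ->
  triplicate_letter i (u ++ v) = u ++ triplicate_letter (i - size u) v.
Proof.
case: i => //= i; rewrite ltnS => leui.
rewrite /triplicate_letter subSn //= take_cat nth_cat drop_cat.
by rewrite !ltnNge leui (leqW leui) /= subSn // -catA.
Qed.

(** Preserving the root label makes the induction close: the rule at a vertex sees only the root
    labels of its two subtrees. *)
Lemma triplicate_labeled (i : nat) (L : ltree) :
  1 < leaves (shape_of L) -> 0 < i <= leaves (shape_of L) ->
  obeys_grammar L ->
  exists L' : ltree,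
    [/\ shape_of L' = triplicate i (shape_of L),
        root_label L' = root_label L,
        leaf_word L' = triplicate_letter i (leaf_word L)
      & obeys_grammar L'].
Proof.
have leaves_gt0 U : 0 < leaves U.
  by elim: U => //= l lP r _; rewrite addn_gt0 lP.
have leaves_gt1 U V : 1 < leaves (Node U V).
  by rewrite /= -[2]/(1 + 1) leq_add.
elim: L i => // a l IHl r IHr i _ /andP[i_gt0 le_i] /= /and3P[rule_a gl gr].
have [le_il|lt_li] := leqP i (leaves (shape_of l)).
  rewrite triplicate_letter_catl ?size_leaf_word ?i_gt0 //.
  (* A leaf child is expanded here, at its parent; any other child has two leaves or more, so the
     induction hypothesis applies. *)
  case: l IHl rule_a gl le_il {le_i} => [b|b l1 l2] IHl rule_a gl le_il.
    have -> : i = 1 by move: le_il => /=; lia.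
    pose c := root_label r.
    exists (LNode a (LLeaf b) (LNode c (LLeaf b) (LNode a (LLeaf b) r))).
    split=> //=; move: rule_a; rewrite gr !ruleE /= -/c.
    by case/and3P=> ab ac bc; rewrite ab ac bc ![c == _]eq_sym ac bc ![b == a]eq_sym
      ab.
  have [|l' [sl' rl' wl' gl']] := IHl i (leaves_gt1 _ _) _ gl.
    by rewrite i_gt0.
  exists (LNode a l' r); split=> //=; first by rewrite sl'.
    by rewrite wl'.
  by rewrite rl' rule_a gl' gr.
rewrite triplicate_letter_catr ?size_leaf_word //.
case: r IHr rule_a gr le_i => [b|b r1 r2] IHr rule_a gr le_i.
  have -> : i - leaves (shape_of l) = 1 by move: le_i => /=; lia.
  pose c := root_label l.
  (* From the top, the rules are [a -> c b], [c -> a b], [a -> c b]. *)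
  exists (LNode a (LNode c (LNode a l (LLeaf b)) (LLeaf b)) (LLeaf b)).
  split=> //=; first by rewrite -!catA.
  move: rule_a; rewrite gl !ruleE /= -/c.
  by case/and3P=> ac ab cb; rewrite ab ac cb ![c == a]eq_sym ac.
have [|r' [sr' rr' wr' gr']] :=
    IHr (i - leaves (shape_of l)) (leaves_gt1 _ _) _ gr.
  by move: le_i => /=; lia.
exists (LNode a l r'); split=> //=; first by rewrite sr'.
  by rewrite wr'.
by rewrite rr' rule_a gl gr'.
Qed.

Lemma parses_triplicate (i : nat) (T : btree) (w : seq letter) :
  1 < leaves T -> 0 < i <= leaves T -> parses T w ->
  parses (triplicate i T) (triplicate_letter i w).
Proof.
move=> gt1 hi [L [sL <- gL]]; rewrite -sL in gt1 hi *.
have [L' [sL' _ wL' gL']] := triplicate_labeled i L gt1 hi gL.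
by exists L'.
Qed.

Theorem theorem18 (n : nat) (T1' T2' : btree) (i : nat) (w : seq letter)
    (hn : 4 <= n)
    (hT1 : leaves T1' = n - 2) (hT2 : leaves T2' = n - 2)
    (hi : 1 <= i <= n - 2)
    (hw : size w = n - 2)
    (hw1 : parses T1' w) (hw2 : parses T2' w) :
  parses (triplicate i T1') (triplicate_letter i w) /\
  parses (triplicate i T2') (triplicate_letter i w).
Proof.
(* With at least two leaves, leaf [i] has a parent and a sibling in each tree. *)
have gt1 : 1 < n - 2 by lia.
by split; apply: parses_triplicate; rewrite ?hT1 ?hT2.
Qed.
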